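(* Let $G$ be a finite simple graph which is both $(P_3\cup P_2)$-free and diamond-free. Then $\chi(G)\leq 4$ if $\omega(G)=2$, $\chi(G)\leq 6$ if $\omega(G)=3$, $\chi(G)\leq 4$ if $\omega(G)=4$, and $G$ is perfect if $\omega(G)\geq 5$.
   Context: All graphs are finite, simple, undirected. $\omega$ is the clique number and $\chi$ the chromatic number. $P_3\cup P_2$ is the disjoint union of a path on 3 vertices and a path on 2 vertices. The diamond is $K_4$ minus an edge (equivalently $2K_1+K_2$). A graph is $H$-free if it has no induced subgraph isomorphic to $H$; $G$ is perfect if $\chi(H)=\omega(H)$ for every induced subgraph $H$ of $G$. *)

(* Defs.v *)
From mathcomp Require Import all_boot.

Set Implicit Arguments.
Unset Strict Implicit.
Unset Printing Implicit Defensive.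

Record sgraph := SGraph {
  vertex :> finType;
  adj : rel vertex;
  adj_sym : symmetric adj;
  adj_irrefl : irreflexive adj
}.

Section Induced.
Variables (G : sgraph) (S : {set G}).
Definition induced_adj : rel {x : G | x \in S} :=
  fun u v => adj (val u) (val v).
Lemma induced_adj_sym : symmetric induced_adj.
Proof. by move=> u v; apply: adj_sym. Qed.
Lemma induced_adj_irrefl : irreflexive induced_adj.
Proof. by move=> u; apply: adj_irrefl. Qed.
Definition induced : sgraph := SGraph induced_adj_sym induced_adj_irrefl.
End Induced.

Definition isomorphic (G H : sgraph) : Prop :=
  exists2 f : G -> H, bijective f & forall x y, adj (f x) (f y) = adj x y.

Definition free (H G : sgraph) : Prop :=
  forall S : {set G}, ~ isomorphic (induced S) H.

Definition clique (G : sgraph) (S : {set G}) : bool :=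
  [forall x in S, forall y in S, (x != y) ==> adj x y].

Definition omega (G : sgraph) : nat := \max_(S : {set G} | clique S) #|S|.

Definition proper_coloring (G : sgraph) (k : nat) (c : {ffun G -> 'I_k}) : bool :=
  [forall x, forall y, adj x y ==> (c x != c y)].

Definition colorable (G : sgraph) (k : nat) : bool :=
  [exists c : {ffun G -> 'I_k}, proper_coloring c].

Lemma ex_colorable (G : sgraph) : exists k, colorable G k.
Proof.
exists #|G|; apply/existsP; exists [ffun x => enum_rank x].
apply/forallP=> x; apply/forallP=> y; apply/implyP=> xy; rewrite !ffunE.
by apply: contraTneq xy => /enum_rank_inj->; rewrite adj_irrefl.
Qed.

Definition chi (G : sgraph) : nat := ex_minn (ex_colorable G).

Definition perfect (G : sgraph) : Prop :=
  forall S : {set G}, chi (induced S) = omega (induced S).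

Section Path.
Variable n : nat.
Definition path_adj : rel 'I_n := fun i j => (i.+1 == j) || (j.+1 == i).
Lemma path_adj_sym : symmetric path_adj.
Proof. by move=> i j; rewrite /path_adj orbC. Qed.
Lemma path_adj_irrefl : irreflexive path_adj.
Proof. by move=> i; rewrite /path_adj orbb gtn_eqF. Qed.
Definition path_graph : sgraph := SGraph path_adj_sym path_adj_irrefl.
End Path.

Section DisjointUnion.
Variables G H : sgraph.
Definition union_adj : rel (G + H) := fun u v =>
  match u, v with
  | inl x, inl y => adj x y
  | inr x, inr y => adj x y
  | _, _ => false
  end.
Lemma union_adj_sym : symmetric union_adj.
Proof. by case=> x [] y //=; apply: adj_sym. Qed.
Lemma union_adj_irrefl : irreflexive union_adj.
Proof. by case=> x /=; apply: adj_irrefl. Qed.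
Definition disjoint_union : sgraph := SGraph union_adj_sym union_adj_irrefl.
End DisjointUnion.

Definition P3_cup_P2 : sgraph := disjoint_union (path_graph 3) (path_graph 2).

(* K_4 on {0,1,2,3} minus the edge {0,1} *)
Definition diamond_adj : rel 'I_4 := fun i j =>
  (i != j) && ~~ ((i < 2) && (j < 2)).
Lemma diamond_adj_sym : symmetric diamond_adj.
Proof. by move=> i j; rewrite /diamond_adj eq_sym andbC [(i < 2) && _]andbC andbC. Qed.
Lemma diamond_adj_irrefl : irreflexive diamond_adj.
Proof. by move=> i; rewrite /diamond_adj eqxx. Qed.
Definition diamond : sgraph := SGraph diamond_adj_sym diamond_adj_irrefl.

(* Main.v *)
(** Fix a maximum clique [A] with [k] vertices. By diamond-freeness a vertex
    outside [A] has at most one neighbour in [A], which splits the complement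
    of [A] into classes [A_a] ([a] in [A]) and the class [A_0] of the vertices
    far from [A]. Vertices lying in classes that miss two vertices of [A] induce
    a disjoint union of cliques, as these two vertices form a [P_2].

    If the complement of [A] is a disjoint union of cliques, then [k] colours
    suffice: colour [A] and every clique injectively, and repair the conflicts
    with [A] by swapping colours within a clique. This covers [k >= 5] (and all
    the induced subgraphs), as well as [k >= 3] when [A_0] has an edge and
    [k = 4] when some class has an edge. For [k = 4] with all classes
    independent, give [A_a] the colour of another vertex of [A]; either all
    classes are inhabited and [A_0] is isolated, or the colour of an empty class
    is free for [A_0]. For [k = 3] each [A_a] induces a matching and gets two
    colours; either some [A_a] is independent and leaves a colour for [A_0], or
    [A_0] is isolated. For [k = 2] the classes [A_a] are independent and [A_0]
    induces a matching. *)

Require Import Defs.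
From mathcomp Require Import all_boot.
From mathcomp Require Import perm zify.

Set Implicit Arguments.
Unset Strict Implicit.
Unset Printing Implicit Defensive.

(** * Cliques, colourings and forbidden induced subgraphs *)

Section Graphs.
Variable G : sgraph.
Implicit Types (p q r s u v x y z : G) (S : {set G}).

Lemma adj_neq x y : adj x y -> x != y.
Proof. by apply: contraTneq => ->; rewrite adj_irrefl. Qed.

Lemma cliqueP S :
  reflect {in S &, forall x y, x != y -> adj x y} (clique S).
Proof.
apply: (iffP forall_inP) => [h x y xS yS|h x xS].
  by move/forall_inP: (h x xS) => /(_ y yS) /implyP.
by apply/forall_inP => y yS; apply/implyP; apply: h.
Qed.

Lemma cliqueU1 x S : clique S -> {in S, forall y, adj x y} -> clique (x |: S).
Proof.
move=> /cliqueP cS xS; apply/cliqueP => u v.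
rewrite !inE => /orP[/eqP->|uS] /orP[/eqP->|vS]; rewrite ?eqxx // => uv.
- exact: xS.
- by rewrite adj_sym xS.
- exact: cS.
Qed.

Lemma clique_set1 x : clique [set x].
Proof. by apply/cliqueP => u v /set1P-> /set1P->; rewrite eqxx. Qed.

Lemma leq_omega S : clique S -> #|S| <= omega G.
Proof. move=> cS; exact: (@leq_bigmax_cond _ (@clique G) (fun S : {set G} => #|S|)). Qed.

Lemma triangle_omega x y z : adj x y -> adj x z -> adj y z -> 3 <= omega G.
Proof.
move=> xy xz yz; have cl : clique (x |: (y |: [set z])).
  apply: cliqueU1 => [|u].
    by apply: cliqueU1 (clique_set1 z) _ => u /set1P->.
  by rewrite !inE => /orP[] /eqP->.
apply: leq_trans (leq_omega cl).
by rewrite !cardsU1 cards1 !inE negb_or !adj_neq.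
Qed.

Lemma K4_omega x y z u : adj x y -> adj x z -> adj x u -> adj y z -> adj y u ->
  adj z u -> 4 <= omega G.
Proof.
move=> xy xz xu yz yu zu; have cl : clique (x |: (y |: (z |: [set u]))).
  apply: cliqueU1 => [|w]; last by rewrite !inE => /or3P[] /eqP->.
  apply: cliqueU1 => [|w]; last by rewrite !inE => /orP[] /eqP->.
  by apply: cliqueU1 (clique_set1 u) _ => w /set1P->.
apply: leq_trans (leq_omega cl).
by rewrite !cardsU1 cards1 !inE !negb_or !adj_neq.
Qed.

Lemma omega_witness : exists2 S : {set G}, clique S & #|S| = omega G.
Proof.
have c0 : clique (set0 : {set G}) by apply/cliqueP => x y; rewrite inE.
have h0 : 0 < #|@clique G| by apply/card_gt0P; exists set0.
have [S cS eS] := eq_bigmax_cond (fun S : {set G} => #|S|) h0.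
by exists S; rewrite // /omega -eS.
Qed.

Lemma chi_leq (T : finType) (c : G -> T) :
  (forall x y, adj x y -> c x != c y) -> chi G <= #|T|.
Proof.
move=> cP; rewrite /chi; case: ex_minnP => m _; apply.
apply/existsP; exists [ffun x => enum_rank (c x)].
apply/forallP => x; apply/forallP => y; apply/implyP => xy.
by rewrite !ffunE (inj_eq enum_rank_inj) cP.
Qed.

Lemma chi_leq_nat k (c : G -> nat) :
  (forall x, c x < k) -> (forall x y, adj x y -> c x != c y) -> chi G <= k.
Proof.
move=> ck cP; rewrite -(card_ord k).
by apply: (chi_leq (c := fun x => Ordinal (ck x))) => x y /cP.
Qed.

Lemma omega_leq_chi : omega G <= chi G.
Proof.
have [S /cliqueP cS <-] := omega_witness.
rewrite /chi; case: ex_minnP => m /existsP[c /forallP cP] _.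
rewrite -(card_ord m) -(card_in_imset (f := c)) ?max_card // => x y xS yS cxy.
apply/eqP; apply: contraT => xy.
have /forallP/(_ y) := cP x.
by rewrite cS //= cxy eqxx.
Qed.

Lemma embedding_not_free (H : sgraph) (f : H -> G) :
  injective f -> (forall i j, adj (f i) (f j) = adj i j) -> ~ free H G.
Proof.
move=> f_inj fE /(_ (f @: setT)); apply.
have fS i : f i \in f @: setT by apply: imset_f.
pose g i : {x | x \in f @: setT} := exist _ (f i) (fS i).
have g_inj : injective g by move=> u v /(congr1 val) /f_inj.
have [|h gK hK] := inj_card_bij g_inj.
  by rewrite card_sig card_imset // cardsT.
exists h; first by exists g.
by move=> x y; rewrite -{2}(hK x) -{2}(hK y) /= /induced_adj /= fE.
Qed.

Lemma no_diamond p q r s : free diamond G ->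
  adj p r -> adj p s -> adj q r -> adj q s -> adj r s -> p != q -> adj p q.
Proof.
move=> hD pr ps qr qs rs npq; apply: contraT => /negbTE pq.
have /= qp := pq; rewrite adj_sym in qp.
pose f (i : diamond) := nth p [:: p; q; r; s] (val i).
case: (@embedding_not_free diamond f) => //.
  have un : uniq [:: p; q; r; s].
    by rewrite /= !inE !negb_or npq !adj_neq.
  move=> i j /eqP; rewrite nth_uniq ?ltn_ord //; first by move/eqP/val_inj.
move=> [[|[|[|[|i]]]] iP] [[|[|[|[|j]]]] jP] //=; rewrite /f /=;
  by rewrite ?adj_irrefl ?pq ?qp ?pr ?ps ?qr ?qs ?rs // adj_sym ?pr ?ps ?qr ?qs ?rs.
Qed.

Lemma no_P3_cup_P2 x y z u v : free P3_cup_P2 G ->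
  adj x y -> adj y z -> x != z -> adj u v ->
  ~~ adj x u -> ~~ adj x v -> ~~ adj y u -> ~~ adj y v -> ~~ adj z u ->
  ~~ adj z v -> adj x z.
Proof.
move=> hP xy yz nxz uv xu xv yu yv zu zv; apply: contraT => xz.
pose f (w : P3_cup_P2) := match w with
  | inl i => nth x [:: x; y; z] (val i)
  | inr i => nth x [:: u; v] (val i)
  end.
have fE w1 w2 : adj (f w1) (f w2) = adj w1 w2.
  case: w1 => [[[|[|[|i]]] iP]|[[|[|i]] iP]] //;
  case: w2 => [[[|[|[|j]]] jP]|[[|[|j]] jP]] //;
  rewrite /f /=; rewrite ?adj_irrefl ?xy ?yz ?uv ?(negbTE xu) ?(negbTE xv)
    ?(negbTE yu) ?(negbTE yv) ?(negbTE zu) ?(negbTE zv) ?(negbTE xz) //;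
  by rewrite adj_sym ?xy ?yz ?uv ?(negbTE xu) ?(negbTE xv)
    ?(negbTE yu) ?(negbTE yv) ?(negbTE zu) ?(negbTE zv) ?(negbTE xz).
case: (@embedding_not_free P3_cup_P2 f) => //.
(* The path avoids [u] and [v]: a path vertex equal to one end of the edge [uv] would be adjacent to
   the other. *)
have un : uniq [:: x; y; z; u; v].
  rewrite /= !inE !negb_or nxz (adj_neq xy) (adj_neq yz) (adj_neq uv) /=.
  rewrite -!andbA; apply/and5P; split; rewrite ?andbT.
  - by apply: contraNneq xv => ->.
  - by apply: contraNneq xu => ->; rewrite adj_sym.
  - by apply: contraNneq yv => ->.
  - by apply: contraNneq yu => ->; rewrite adj_sym.
  apply/andP; split.
  - by apply: contraNneq zv => ->.
  - by apply: contraNneq zu => ->; rewrite adj_sym.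
(* [g] sends the two summands to disjoint positions of the list, so injectivity of [f] follows from
   [un]. *)
pose g (w : P3_cup_P2) := match w with inl i => val i | inr i => 3 + val i end.
have gE w : f w = nth x [:: x; y; z; u; v] (g w).
  by case: w => [[[|[|[|i]]] iP]|[[|[|i]] iP]].
have gP w : g w < 5.
  by case: w => [[[|[|[|i]]] iP]|[[|[|i]] iP]].
move=> w1 w2 /eqP; rewrite !gE nth_uniq ?gP // => /eqP.
case: w1 w2 => [i|i] [j|j] /=.
- by move/val_inj->.
- by move=> e; have := ltn_ord i; rewrite e ltnNge leq_addr.
- by move=> e; have := ltn_ord j; rewrite -e ltnNge leq_addr.
- by move/addnI/val_inj->.
Qed.

End Graphs.

(** Each vertex has at most one partner, so marking the end of larger [enum_rank] in every edge
    separates the two ends. *)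
Lemma matching_bicoloring (T : finType) (r : rel T) :
  symmetric r -> irreflexive r -> (forall x y z, r x y -> r x z -> y = z) ->
  exists b : T -> bool, forall x y, r x y -> b x != b y.
Proof.
move=> r_sym r_irr r_fun.
exists (fun x => [exists y, r x y && (enum_rank y < enum_rank x)]) => x y xy.
have bE u v : r u v ->
    [exists w, r u w && (enum_rank w < enum_rank u)] = (enum_rank v < enum_rank u).
  move=> uv; apply/existsP/idP => [[w /andP[uw]]|vu].
    by rewrite (r_fun _ _ _ uw uv).
  by exists v; rewrite uv.
rewrite (bE x y) // (bE y x) 1?r_sym //.
have nxy : val (enum_rank x) != val (enum_rank y).
  by rewrite (inj_eq val_inj) (inj_eq enum_rank_inj); apply: contraTneq xy => ->; rewrite r_irr.
by rewrite neq_ltn in nxy *; case: ltngtP nxy.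
Qed.

(** * Colouring a clique together with a disjoint union of cliques *)

Section ClusterColoring.
Variables (G : sgraph) (A : {set G}).
Hypothesis clA : clique A.
Hypothesis one_nbr : forall w a b,
  w \notin A -> a \in A -> b \in A -> adj w a -> adj w b -> a = b.
Hypothesis W_cluster : forall x y z, x \notin A -> y \notin A -> z \notin A ->
  adj x y -> adj y z -> x != z -> adj x z.

(** Under [W_cluster] the blocks partition the vertices into [A] and the connected components of its
    complement. *)
Definition block (w : G) : {set G} :=
  if w \in A then A else [set u | (u \notin A) && ((u == w) || adj w u)].

Lemma mem_block w : w \in block w.
Proof. by rewrite /block; case: ifPn => // wA; rewrite inE wA eqxx. Qed.

Lemma block_side w u : u \in block w -> (u \in A) = (w \in A).
Proof. by rewrite /block; case: ifP => // _; rewrite inE => /andP[/negbTE]. Qed.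

Lemma adj_block x y : (x \in A) = (y \in A) -> adj x y -> y \in block x.
Proof.
by rewrite /block => ->; case: ifPn => // yA xy; rewrite inE yA xy orbT.
Qed.

Lemma block_eq w u : u \in block w -> block u = block w.
Proof.
move=> uw; have eA := block_side uw; move: uw; rewrite /block eA.
case: ifPn => // wA; rewrite inE eA wA => /= /orP[/eqP-> //|wu].
have uA : u \notin A by rewrite eA.
apply/setP => z; rewrite !inE; case: (boolP (z \in A)) => //= zA.
have [->|nzu] := eqVneq z u; first by rewrite wu orbT.
have [->|nzw] := eqVneq z w; first by rewrite adj_sym wu.
apply/idP/idP => /= h; first by apply: (W_cluster (y := u)); rewrite // eq_sym.
by apply: (W_cluster (y := w)); rewrite // 1?adj_sym // eq_sym.
Qed.

Lemma clique_block w : clique (block w).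
Proof.
rewrite {1}/block; case: ifPn => // wA; apply/cliqueP => x y.
rewrite !inE => /andP[xA xw] /andP[yA yw] nxy.
case/orP: xw => [/eqP ex|xw]; first by move: yw; rewrite ex eq_sym -ex (negbTE nxy).
case/orP: yw => [/eqP->|yw]; first by rewrite adj_sym.
by apply: (W_cluster (y := w)); rewrite // adj_sym.
Qed.

Let k := omega G.
Let injective_on_blocks (c : G -> 'I_k) :=
  forall x y, y \in block x -> c x = c y -> x = y.
Let conflicts (c : G -> 'I_k) : {set G} :=
  [set w | (w \notin A) && [exists a in A, adj w a && (c w == c a)]].

(** Let [v] share its colour with its neighbour [a] in [A]. Inside the block of [v], the colour of
    [v] is swapped with a colour [b] that no neighbour of [a] in this block has. This repairs [v]
    and creates no new conflict. *)
Lemma fewer_conflicts c : injective_on_blocks c -> conflicts c != set0 ->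
  exists2 c', injective_on_blocks c' & #|conflicts c'| < #|conflicts c|.
Proof.
move=> c_inj /set0Pn[v v_conf]; have := v_conf.
rewrite inE => /andP[vA /existsP[a /and3P[aA va /eqP cva]]].
(* If every colour class of the block of [v] met the neighbourhood of [a],
   [a] would extend that neighbourhood to a clique of size [omega G + 1]. *)
have [b bv bP] : exists2 b, b != c v & forall u, u \in block v -> c u = b -> ~~ adj u a.
  have /existsP[b /andP[bv /forall_inP bP]] :
      [exists b, (b != c v) && [forall u in block v, (c u == b) ==> ~~ adj u a]].
    apply: contraT => /existsPn no_b.
    pose S := [set u in block v | adj u a].
    have sub : [set: 'I_k] \subset c @: S.
      apply/subsetP => b _; have := no_b b; rewrite negb_and negbK.
      have [-> _|_ /= /forall_inPn[u uv]] := eqVneq b (c v).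
        by apply: imset_f; rewrite inE mem_block.
      rewrite negb_imply negbK => /andP[/eqP<- ua].
      by apply: imset_f; rewrite inE uv.
    have := subset_leq_card sub; rewrite cardsT card_ord => kS.
    have clS : clique (a |: S).
      apply: cliqueU1 => [|y]; last by rewrite inE adj_sym => /andP[].
      apply/cliqueP => x y; rewrite !inE => /andP[xv _] /andP[yv _].
      exact: (cliqueP _ (clique_block v)).
    have := leq_omega clS; rewrite cardsU1 inE adj_irrefl andbF add1n.
    by rewrite ltnNge (leq_trans kS) ?leq_imset_card.
  by exists b => // u /bP /implyP h /eqP.
pose c' w := if w \in block v then tperm (c v) b (c w) else c w.
exists c' => [x y xy|].
  have e : (x \in block v) = (y \in block v).
    apply/idP/idP => h; first by rewrite -(block_eq h).
    by rewrite -(block_eq h) (block_eq xy) mem_block.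
  by rewrite /c' e; case: ifP => _ => [/perm_inj|]; apply: c_inj.
(* Only two vertices of the block change colour. [v] now has colour [b], while its only neighbour in
   [A] is [a]. A vertex that had colour [b] now has the colour of [a], but is not adjacent to
   [a]. *)
have sub w : w \in conflicts c' -> (w != v) && (w \in conflicts c).
  rewrite inE => /andP[wA /existsP[d /and3P[dA wd]]].
  have dv : d \notin block v by apply: contraL dA => /block_side ->.
  rewrite /c' (negbTE dv).
  have conf_w : c w = c d -> w \in conflicts c.
    by move=> e; rewrite inE wA; apply/existsP; exists d; rewrite dA wd e /=.
  case: ifPn => [wv|wv /eqP /conf_w ->]; last first.
    by rewrite andbT; apply: contraNneq wv => ->; apply: mem_block.
  case: tpermP => [/esym cw|cw|/eqP cwv _ /eqP /conf_w ->].
  - have ew : w = v by apply/esym/c_inj.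
    rewrite ew in wd; rewrite (one_nbr vA dA aA wd va) -cva => /eqP e.
    by rewrite e eqxx in bv.
  - rewrite cva => /eqP /c_inj ad; have := bP w wv cw.
    by rewrite ad ?wd // /block aA.
  - by rewrite andbT; apply: contraNneq cwv => ->.
apply: proper_card; apply/properP; split.
  by apply/subsetP => w /sub /andP[].
by exists v => //; apply/negP => /sub; rewrite eqxx.
Qed.

Lemma cluster_coloring : chi G <= omega G.
Proof.
(* Each block is coloured by its own enumeration; being a clique, it needs at most [k] colours. *)
have [c0 c0_inj] : exists c, injective_on_blocks c.
  have ck x : index x (enum (block x)) < k.
    apply: leq_trans (leq_omega (clique_block x)).
    by rewrite cardE index_mem mem_enum mem_block.
  exists (fun x => Ordinal (ck x)) => x y xy /(congr1 val) /=.
  rewrite (block_eq xy) => e; rewrite -(nth_index x (s := enum (block x)) (x := x)).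
    by rewrite e nth_index // mem_enum.
  by rewrite mem_enum mem_block.
have [c c_inj c_conf] : exists2 c, injective_on_blocks c & conflicts c = set0.
  have [n] := ubnP #|conflicts c0|; elim: n c0 c0_inj => // n IHn c c_inj cn.
  have [c_conf|/(fewer_conflicts c_inj)[c' c'_inj c'c]] := eqVneq (conflicts c) set0.
    by exists c.
  by apply: (IHn c'); rewrite // (leq_trans c'c).
have mixed x y : x \notin A -> y \in A -> adj x y -> c x != c y.
  move=> xA yA xy; apply/negP => cxy; have : x \in conflicts c.
    by rewrite inE xA; apply/existsP; exists y; rewrite yA xy.
  by rewrite c_conf inE.
rewrite -[leqRHS]card_ord; apply: (chi_leq (c := c)) => x y xy.
case: (boolP (x \in A)) (boolP (y \in A)) => [] xA [] yA.
- by apply: contraTneq xy => /c_inj->; rewrite ?adj_irrefl // /block xA.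
- by rewrite eq_sym mixed // adj_sym.
- exact: mixed.
- apply: contraTneq (xy) => /c_inj->; rewrite ?adj_irrefl //.
  by apply: adj_block; rewrite // (negbTE xA) (negbTE yA).
Qed.

End ClusterColoring.

(** * Classes of vertices around a maximum clique *)

Section MaximumClique.
Variables (G : sgraph) (A : {set G}).
Hypothesis hP : free P3_cup_P2 G.
Hypothesis hD : free diamond G.
Hypothesis clA : clique A.
Hypothesis cardA : #|A| = omega G.
Implicit Types (t : seq nat) (a b u v w x y z : G).

(** If [w] sees two vertices of [A], every further [c] in [A] sees them too, so diamond-freeness
    makes [w] adjacent to [c]. Then [w] extends [A], against maximality. *)
Lemma max_clique_nbr w a b :
  w \notin A -> a \in A -> b \in A -> adj w a -> adj w b -> a = b.
Proof.
move=> wA aA bA wa wb; apply: contraNeq wA => nab.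
have [wc|/forall_inPn[c cA wc]] := boolP [forall c in A, adj w c].
  have := leq_omega (cliqueU1 clA (forall_inP wc)).
  by rewrite cardsU1 -cardA; case: (w \in A); rewrite ?ltnn.
have ac : c != a by apply: contraNneq wc => ->.
have bc : c != b by apply: contraNneq wc => ->.
have [->//|nwc] := eqVneq w c.
case/negP: wc; apply: (no_diamond (r := a) (s := b)) => //;
  exact: (cliqueP _ clA).
Qed.

(** Naming the vertices of [A] by numbers makes them comparable with labels and lets both serve in
    colour formulas. *)
Definition rank a := index a (enum A).

(* The vertices outside [A] without neighbour in [A] get the label [#|A|]. *)
Definition label w := find (adj w) (enum A).

Lemma rank_ltn a : a \in A -> rank a < #|A|.
Proof. by move=> aA; rewrite /rank cardE index_mem mem_enum. Qed.

Lemma rank_inj : {in A &, injective rank}.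
Proof.
move=> a b aA bA e; rewrite -(nth_index a (s := enum A) (x := a)) ?mem_enum //.
by rewrite -/(rank a) e nth_index ?mem_enum.
Qed.

Lemma rank_onto i : i < #|A| -> exists2 a, a \in A & rank a = i.
Proof.
move=> iA; have /card_gt0P[a _] : 0 < #|A| by apply: leq_trans iA.
rewrite cardE in iA; exists (nth a (enum A) i); last by rewrite /rank index_uniq ?enum_uniq.
by rewrite -mem_enum mem_nth.
Qed.

Lemma label_leq w : label w <= #|A|.
Proof. by rewrite /label cardE find_size. Qed.

(** [find] returns the first neighbour in [A], which by [max_clique_nbr] is the only one. *)
Lemma adj_label w a : w \notin A -> a \in A -> adj w a = (label w == rank a).
Proof.
move=> wA aA; apply/idP/eqP => [wa|lw].
  have h : has (adj w) (enum A) by apply/hasP; exists a; rewrite // mem_enum.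
  have := nth_find a h; rewrite -/(label w) => wl.
  have lA : label w < size (enum A) by rewrite -has_find.
  have <- : nth a (enum A) (label w) = a.
    by apply: (max_clique_nbr (w := w)); rewrite // -mem_enum mem_nth.
  by rewrite /rank index_uniq ?enum_uniq.
have h : has (adj w) (enum A) by rewrite has_find -/(label w) lw -cardE rank_ltn.
by have := nth_find a h; rewrite -/(label w) lw /rank nth_index ?mem_enum.
Qed.

(** The ranks of [A] are distinct, so [t] cannot contain them all; the label [#|A|] is no rank and
    excludes no vertex. *)
Lemma far_vertex t : size t < #|A| ->
  exists a, [/\ a \in A, rank a \notin t &
    forall w, w \notin A -> label w \in #|A| :: t -> ~~ adj w a].
Proof.
move=> tA; have [a aA ta] : exists2 a, a \in A & rank a \notin t.
  apply/exists_inP; apply: contraLR tA => /exists_inPn h.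
  rewrite -leqNgt cardE -(size_map rank); apply: uniq_leq_size.
    by rewrite map_inj_in_uniq ?enum_uniq // => x y; rewrite !mem_enum; apply: rank_inj.
  by move=> _ /mapP[a aA ->]; have := h a; rewrite negbK -mem_enum; apply.
exists a; split=> // w wA; rewrite adj_label // inE => lw.
apply: contraTneq lw => ->; rewrite negb_or ta andbT.
by rewrite ltn_eqF // rank_ltn.
Qed.

(** Two vertices of [A] whose ranks avoid [t] form a [P_2] far from [x], [y], [z], which therefore
    cannot induce a [P_3]. *)
Lemma P3_label t x y z : size t + 2 <= #|A| ->
  x \notin A -> y \notin A -> z \notin A ->
  label x \in #|A| :: t -> label y \in #|A| :: t -> label z \in #|A| :: t ->
  adj x y -> adj y z -> x != z -> adj x z.
Proof.
move=> tA xA yA zA xt yt zt xy yz nxz.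
have [|a [aA at_ aP]] := @far_vertex t; first by lia.
have [|b [bA bt bP]] := @far_vertex (rank a :: t); first by rewrite /=; lia.
have sub i : i \in #|A| :: t -> i \in #|A| :: rank a :: t.
  by rewrite !inE => /orP[->//|->]; rewrite !orbT.
have nab : a != b.
  by apply: contraNneq bt => ->; rewrite inE eqxx.
apply: (no_P3_cup_P2 (y := y) (u := a) (v := b)) => //; rewrite ?aP ?bP ?sub //.
exact: (cliqueP _ clA).
Qed.

(* [P_3] is formed by [v], its neighbour in [A], and a vertex of [A] far from
   the edge [xy]. *)
Lemma edge_label t v x y : size t < #|A| ->
  v \notin A -> x \notin A -> y \notin A ->
  label v \in t -> label v < #|A| ->
  label x \in #|A| :: t -> label y \in #|A| :: t ->
  label x != label v -> label y != label v ->
  adj x y -> adj v x || adj v y.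
Proof.
move=> tA vA xA yA vt vk xt yt xv yv xy; apply: contraT.
rewrite negb_or => /andP[nvx nvy].
have [b [bA bt bP]] := far_vertex tA; have [a aA av] := rank_onto vk.
have nab : a != b by apply: contraNneq bt => <-; rewrite av.
have nvb : ~~ adj v b by rewrite bP // inE vt orbT.
case/negP: (nvb); apply: (no_P3_cup_P2 (y := a) (u := x) (v := y)) => //.
- by rewrite adj_label // av.
- exact: (cliqueP _ clA).
- by apply: contraNneq vA => ->.
- by rewrite adj_sym adj_label // av.
- by rewrite adj_sym adj_label // av.
- by rewrite adj_sym bP.
- by rewrite adj_sym bP.
Qed.

(** [edge_label] joins [v] to one end of the edge, and [P3_label] then joins it to the other. *)
Lemma edge_label_both t v x y : size t + 2 <= #|A| ->
  v \notin A -> x \notin A -> y \notin A ->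
  label v \in t -> label v < #|A| ->
  label x \in #|A| :: t -> label y \in #|A| :: t ->
  label x != label v -> label y != label v ->
  adj x y -> adj v x && adj v y.
Proof.
move=> tA vA xA yA vt vk xt yt xv yv xy.
have vt' : label v \in #|A| :: t by rewrite inE vt orbT.
have nvx : v != x by apply: contraNneq xv => ->.
have nvy : v != y by apply: contraNneq yv => ->.
have /orP[vx|vy] := @edge_label t v x y ltac:(lia) vA xA yA vt vk xt yt xv yv xy.
  by rewrite vx (P3_label tA (y := x)).
by rewrite vy (P3_label tA (y := y)) // adj_sym.
Qed.

(** * Situations in which the complement of the maximum clique is a disjoint union of cliques *)

Lemma cluster_bound : (forall x y z, x \notin A -> y \notin A -> z \notin A ->
  adj x y -> adj y z -> x != z -> adj x z) -> chi G <= omega G.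
Proof. exact: cluster_coloring clA max_clique_nbr. Qed.

(** Every vertex of [Q] sees both ends of the edge [xy], so by diamond-freeness [Q] with [x] and [y]
    is a clique. Hence at most [#|A| - 2] labels below [#|A|] occur, and [P3_label] applies to the
    whole complement. *)
Lemma free_edge_bound x y : 3 <= #|A| -> x \notin A -> y \notin A -> adj x y ->
  label x = #|A| -> label y = #|A| -> chi G <= omega G.
Proof.
move=> A3 xA yA xy lx ly.
pose Q := [set q | (q \notin A) && (label q < #|A|)].
have Qadj q : q \in Q -> adj q x && adj q y.
  rewrite inE => /andP[qA lq].
  by apply: (@edge_label_both [:: label q]);
    rewrite ?lx ?ly ?inE ?eqxx // gtn_eqF.
have clQ : clique (x |: (y |: Q)).
  apply: cliqueU1 => [|q]; last first.
    by rewrite in_setU1 => /orP[/eqP->//|/Qadj/andP[qx _]]; rewrite adj_sym.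
  apply: cliqueU1 => [|q /Qadj/andP[_ qy]]; last by rewrite adj_sym.
  apply/cliqueP => q q' /Qadj/andP[qx qy] /Qadj/andP[q'x q'y].
  exact: (no_diamond hD qx qy q'x q'y xy).
have cQ : #|Q| + 2 <= #|A|.
  have := leq_omega clQ; rewrite cardA !cardsU1 !inE (negbTE (adj_neq xy)).
  by rewrite lx ly ltnn !andbF; lia.
apply: cluster_bound => u v w uA vA wA.
have Qt q : q \notin A -> label q \in #|A| :: [seq label q | q <- enum Q].
  move=> qA; rewrite inE; have := label_leq q; rewrite leq_eqVlt => /orP[->//|lq].
  by rewrite map_f ?orbT // mem_enum inE qA.
by apply: (P3_label (t := [seq label q | q <- enum Q])); rewrite ?Qt // size_map -cardE.
Qed.

(** A vertex [q] with another label below [#|A|] would see both [x] and [y], as does their common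
    neighbour [a] in [A]. Diamond-freeness would make [q] adjacent to [a], so only the labels [#|A|]
    and [label x] occur. *)
Lemma class_edge_bound x y : 4 <= #|A| -> x \notin A -> y \notin A -> adj x y ->
  label x < #|A| -> label x = label y -> chi G <= omega G.
Proof.
move=> A4 xA yA xy lx exy; have [a aA ax] := rank_onto lx.
have Wt q : q \notin A -> label q \in [:: #|A|; label x].
  move=> qA; have := label_leq q; rewrite leq_eqVlt !inE => /orP[->//|lq].
  apply: contraT; rewrite negb_or => /andP[_ qx].
  have /andP[qx' qy] : adj q x && adj q y.
    by apply: (@edge_label_both [:: label q; label x]);
      rewrite -?exy ?inE ?eqxx ?orbT // eq_sym.
  case/negP: (qx); rewrite -ax -adj_label //.
  apply: (no_diamond hD qx' qy _ _ xy).
  - by rewrite adj_sym adj_label // ax.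
  - by rewrite adj_sym adj_label // ax exy.
  - by apply: contraNneq qA => ->.
apply: cluster_bound => u v w uA vA wA.
by apply: (P3_label (t := [:: label x])); rewrite ?Wt //=; lia.
Qed.

(** * The bounds for each clique number *)

Lemma omega2_bound : #|A| = 2 -> chi G <= 4.
Proof.
move=> A2; have no_triangle x y z : adj x y -> adj x z -> ~~ adj y z.
  move=> xy xz; apply/negP => yz.
  by have := triangle_omega xy xz yz; rewrite -cardA A2.
have class_indep x y : x \notin A -> y \notin A -> adj x y -> label x < 2 ->
    label x != label y.
  move=> xA yA xy; rewrite -A2 => /rank_onto[a aA ax]; apply/eqP => exy.
  have := no_triangle a x y; rewrite xy !(adj_sym a) !adj_label // -exy ax eqxx.
  by move=> /(_ isT isT).
pose r x y := [&& x \notin A, y \notin A, adj x y, label x == 2 & label y == 2].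
have [||x y z|b bP] := @matching_bicoloring G r.
- by move=> x y; apply/and5P/and5P => -[]; split; rewrite // adj_sym.
- by move=> x; rewrite /r adj_irrefl !andbF.
(* Far vertices miss both vertices of [A]; two distinct far neighbours of [x] would be adjacent by
   [P3_label] and close a triangle. *)
- case/and5P=> xA yA xy lx ly /and5P[_ zA xz _ lz].
  apply/eqP; apply: contraNT (no_triangle x y z xy xz) => nyz.
  by apply: (P3_label (t := [::]) (y := x)); rewrite // ?inE ?A2 // adj_sym.
(* The ranks are exchanged on [A], which frees colour [i] for the class of label [i]; the far
   matching takes colours 2 and 3. *)
pose c x := if x \in A then 1 - rank x else if label x < 2 then label x else 2 + b x.
have label2 x : label x <= 2 by rewrite -A2 label_leq.
apply: (chi_leq_nat (c := c)) => [x|].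
  rewrite /c; case: ifP => _; first by lia.
  by case: ifP; [lia | case: (b x)].
have c_mixed x y : x \notin A -> y \in A -> adj x y -> c x != c y.
  move=> xA yA; have := rank_ltn yA; rewrite adj_label // /c yA (negbTE xA) A2.
  by move=> ry /eqP->; rewrite ry; lia.
move=> x y xy; case: (boolP (x \in A)) (boolP (y \in A)) => [] xA [] yA.
- have nr : rank x != rank y by rewrite (inj_in_eq rank_inj) // adj_neq.
  by have := rank_ltn xA; have := rank_ltn yA; rewrite /c xA yA A2; lia.
- by rewrite eq_sym c_mixed // adj_sym.
- exact: c_mixed.
rewrite /c (negbTE xA) (negbTE yA).
have := class_indep x y xA yA xy; have := class_indep y x yA xA.
rewrite adj_sym => /(_ xy); have := bP x y; rewrite /r xA yA xy /=.
have := label2 x; have := label2 y.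
case: (label x) => [|[|[|i]]]; case: (label y) => [|[|[|j]]] //= _ _;
  case: (b x); case: (b y) => //= hb h1 h2;
  first [by have := hb isT | by have := h1 isT | by have := h2 isT].
Qed.

Lemma omega3_bound : #|A| = 3 -> chi G <= 6.
Proof.
move=> A3; have label3 x : label x <= 3 by rewrite -A3 label_leq.
have [/existsP[x /existsP[y /and5P[xA yA xy /eqP lx /eqP ly]]]|indep0] :=
    boolP [exists x, exists y,
      [&& x \notin A, y \notin A, adj x y, label x == 3 & label y == 3]].
  have := @free_edge_bound x y; rewrite -cardA A3 => /(_ isT xA yA xy lx ly) h.
  exact: leq_trans h _.
have {}indep0 x y : x \notin A -> y \notin A -> adj x y -> label x = 3 -> label y != 3.
  move=> xA yA xy lx; apply: contra indep0 => ly.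
  by apply/existsP; exists x; apply/existsP; exists y; rewrite xA yA xy lx ly.
pose class_edge (p : nat) x y := [&& x \notin A, y \notin A, adj x y, label x == p & label y == p].
pose r x y := class_edge (label x) x y && (label x < 3).
have [||x y z|b bP] := @matching_bicoloring G r.
- move=> x y; rewrite /r /class_edge adj_sym !eqxx /= (eq_sym (label y)).
  by case: eqP => [->|]; do 3!case: (_ \notin A) => //; rewrite ?andbF.
- by move=> x; rewrite /r /class_edge adj_irrefl !andbF.
- case/andP=> /and5P[xA yA xy _ ly] lx /andP[/and5P[_ zA xz _ lz] _].
  (* Two distinct partners of [x] in its class would be adjacent, and form a [K_4] with [x] and
     their common neighbour in [A]. *)
  have [//|nyz] := eqVneq y z; have yz : adj y z.
    apply: (P3_label (t := [:: label x]) (y := x));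
      by rewrite // ?(eqP ly) ?(eqP lz) ?inE ?eqxx ?orbT ?A3 // adj_sym.
  have [a aA ax] : exists2 a, a \in A & rank a = label x by apply: rank_onto; rewrite A3.
  have al u : u \notin A -> label u == label x -> adj a u.
    by move=> uA lu; rewrite adj_sym adj_label // ax.
  have := K4_omega (al x xA (eqxx _)) (al y yA ly) (al z zA lz) xy xz yz.
  by rewrite -cardA A3.
(* Class [p] receives the colours [2 p] and [2 p + 1]. *)
pose c (q : nat) x := if x \in A then 2 * ((rank x).+1 %% 3) else
  if label x == 3 then q else 2 * label x + (b x && (2 * label x + 1 != q)).
(* [q] is the colour of the far vertices. If it is the second colour of some class, that class falls
   back on its first colour alone and so must be independent. The cyclic shift on [A] keeps each
   vertex off both colours of its own class. *)
have c_bound q : q < 6 -> (forall x y, x \notin A -> y \notin A -> adj x y ->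
    label x = 3 -> c q y != q) ->
    (forall x y, class_edge (label x) x y -> 2 * label x + 1 != q) -> chi G <= 6.
  move=> q6 c0 cq; apply: (chi_leq_nat (c := c q)) => [x|].
    rewrite /c; case: ifP => _; first by lia.
    by have := label3 x; case: eqP => // lx; case: (b x && _); lia.
  have c_mixed x y : x \notin A -> y \in A -> adj x y -> c q x != c q y.
    move=> xA yA; have := rank_ltn yA; rewrite adj_label // /c yA (negbTE xA) A3.
    by move=> ry /eqP->; rewrite (ltn_eqF ry); case: (b x && _); lia.
  move=> x y xy; case: (boolP (x \in A)) (boolP (y \in A)) => [] xA [] yA.
  - have nr : rank x != rank y by rewrite (inj_in_eq rank_inj) // adj_neq.
    by have := rank_ltn xA; have := rank_ltn yA; rewrite /c xA yA A3; lia.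
  - by rewrite eq_sym c_mixed // adj_sym.
  - exact: c_mixed.
  have [lx|lx] := eqVneq (label x) 3.
    by rewrite eq_sym {2}/c (negbTE xA) lx eqxx (c0 x).
  have [ly|ly] := eqVneq (label y) 3.
    by rewrite {2}/c (negbTE yA) ly eqxx (c0 y) // adj_sym.
  rewrite /c (negbTE xA) (negbTE yA) (negbTE lx) (negbTE ly).
  have [exy|nxy] := eqVneq (label x) (label y); last first.
    by case: (b x && _); case: (b y && _); lia.
  have e : class_edge (label x) x y by rewrite /class_edge xA yA xy exy !eqxx.
  have bxy : b x != b y by apply: bP; rewrite /r e ltn_neqAle lx label3.
  by rewrite -exy (cq x y e) !andbT eqn_add2l; case: (b x) (b y) bxy => [] [].
(* An independent class [p] gives up its second colour [2 * p + 1] to the far vertices. *)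
have [/existsP[p /existsPn no_edge]|all_edge] :=
    boolP [exists p : 'I_3, ~~ [exists x, exists y, class_edge p x y]].
  apply: (c_bound (2 * p + 1)) => [|x y xA yA xy lx|x y exy].
  - by have := ltn_ord p; lia.
  - have ly := indep0 x y xA yA xy lx; rewrite /c (negbTE yA) (negbTE ly).
    have [->|nyp] := eqVneq (label y) (nat_of_ord p); first by rewrite eqxx andbF; lia.
    by case: (b y && _); lia.
  - rewrite eqn_add2r eqn_pmul2l //; apply: contraTneq exy => ->.
    by have /existsPn := no_edge x; apply.
have edge p : p < 3 -> exists x y, class_edge p x y.
  move=> p3; have /existsPn/(_ (Ordinal p3)) := all_edge; rewrite negbK.
  by move=> /existsP[x /existsP[y]]; exists x, y.
have isolated z v : z \notin A -> v \notin A -> adj z v -> label z = 3 -> False.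
  move=> zA vA zv lz.
  (* Each vertex of class [p] sees [z] or [w], and [z] sees both or neither of [x] and [y]. If
     neither, then [w] sees both, as does the vertex of [A] of rank [p]; diamond-freeness makes
     these two adjacent, against [p != q]. *)
  have cover p q w x y : q < 3 -> p != q -> w \notin A -> label w = q -> adj z w ->
      class_edge p x y -> p < 3 -> adj z x && adj z y.
    move=> q3 pq wA lw zw /and5P[xA yA xy /eqP lx /eqP ly] p3.
    have near u : u \notin A -> label u = p -> adj u z || adj u w.
      move=> uA lu; apply: (@edge_label [:: p; q]);
        by rewrite ?A3 ?lu ?lz ?lw ?inE ?eqxx ?orbT // ?(gtn_eqF p3) // eq_sym.
    have zxy u u' : u \notin A -> u' \notin A -> label u = p -> label u' = p ->
        adj u u' -> adj z u -> adj z u'.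
      move=> uA u'A lu lu' uu' zu.
      apply: (P3_label (t := [:: p]) (y := u));
        rewrite ?A3 ?lu ?lu' ?lz ?inE ?eqxx ?orbT //.
      by apply: contraTneq p3 => e; rewrite -lu' -e lz.
    have [zx|nzx] := boolP (adj z x); first exact: zxy zx.
    have [zy|nzy] := boolP (adj z y).
      by case/negP: nzx; apply: zxy zy; rewrite // adj_sym.
    have := near x xA lx; have := near y yA ly.
    rewrite !(adj_sym _ z) (negbTE nzx) (negbTE nzy) /= => yw xw.
    have [a aA ap] : exists2 a, a \in A & rank a = p by apply: rank_onto; rewrite A3.
    have : adj w a.
      apply: (no_diamond hD (r := x) (s := y)); rewrite // 1?adj_sym //.
      - by rewrite adj_label // lx ap.
      - by rewrite adj_label // ly ap.
      - by apply: contraNneq wA => ->.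
    by rewrite adj_label // lw ap eq_sym (negbTE pq).
  have lv : label v < 3.
    by rewrite ltn_neqAle label3 andbT; apply: indep0 lz.
  have [p p3 pv] : exists2 p, p < 3 & p != label v.
    by exists ((label v).+1 %% 3); lia.
  have [x [y exy]] := edge p p3; have /andP[zx zy] := cover _ _ _ _ _ lv pv vA erefl zv exy p3.
  have /and5P[xA yA xy /eqP lx /eqP ly] := exy.
  have [x' [y' exy']] := edge _ lv; have vp : label v != p by rewrite eq_sym.
  have /andP[zx' _] := cover _ _ _ _ _ p3 vp xA lx zx exy' lv.
  have /and5P[x'A _ _ /eqP lx' _] := exy'.
  (* [x'] sees one end of [xy]. The edge from [z] to that end lies in triangles with [x'] and with
     the other end, so diamond-freeness joins these two. *)
  have x'xy : adj x' x && adj x' y.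
    have /orP[x'x|x'y] : adj x' x || adj x' y.
    - apply: (@edge_label [:: p; label v]);
        by rewrite ?A3 ?lx ?ly ?lx' ?inE ?eqxx ?orbT.
    - rewrite x'x (no_diamond hD (r := z) (s := x)) //; try by rewrite adj_sym.
      by apply: contraNneq vp => e; rewrite -lx' e ly.
    - rewrite x'y andbT (no_diamond hD (r := z) (s := y)) //; try by rewrite adj_sym.
      by apply: contraNneq vp => e; rewrite -lx' e lx.
  case/andP: x'xy => x'x x'y.
  have [a aA ap] : exists2 a, a \in A & rank a = p by apply: rank_onto; rewrite A3.
  (* [x'] and [a] both see the edge [xy], yet [x'] has a label other than [p]. *)
  have : adj x' a.
    apply: (no_diamond hD (r := x) (s := y)); rewrite // 1?adj_sym //.
    - by rewrite adj_label // lx ap.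
    - by rewrite adj_label // ly ap.
    - by apply: contraNneq x'A => ->.
  by rewrite adj_label // lx' ap (negbTE vp).
(* Far vertices have no neighbours at all here, and the even colour 0 is no class's second
   colour. *)
apply: (c_bound 0) => [//|x y xA yA xy lx|x y _]; last by rewrite addn1.
by case: (isolated x y).
Qed.

Lemma omega4_bound : #|A| = 4 -> chi G <= 4.
Proof.
move=> A4; have label4 x : label x <= 4 by rewrite -A4 label_leq.
have [/existsP[x /existsP[y /and4P[xA yA xy /eqP lxy]]]|indep] :=
    boolP [exists x, exists y,
      [&& x \notin A, y \notin A, adj x y & label x == label y]].
  rewrite -A4 cardA; have := label4 x; rewrite leq_eqVlt => /orP[/eqP lx|lx].
    by apply: (free_edge_bound _ xA yA xy); rewrite -?lxy A4.
  by apply: (class_edge_bound _ xA yA xy); rewrite ?A4.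
have {}indep x y : x \notin A -> y \notin A -> adj x y -> label x != label y.
  move=> xA yA xy; apply: contra indep => exy.
  by apply/existsP; exists x; apply/existsP; exists y; rewrite xA yA xy exy.
(* [A] is coloured by rank and the class of label [i] by [s i]; [s i != i] handles the edges between
   [A] and its classes. *)
have coloring (s : nat -> nat) : (forall i, i < 4 -> s i < 4) -> s 4 < 4 ->
    (forall i, i < 4 -> s i != i) ->
    (forall x y, x \notin A -> y \notin A -> adj x y -> s (label x) != s (label y)) ->
    chi G <= 4.
  move=> s4 s44 sn sW; pose c x := if x \in A then rank x else s (label x).
  apply: (chi_leq_nat (c := c)) => [x|].
    rewrite /c; case: ifP => [/rank_ltn|_]; first by rewrite A4.
    by have := label4 x; rewrite leq_eqVlt => /orP[/eqP->|/s4].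
  have c_mixed x y : x \notin A -> y \in A -> adj x y -> c x != c y.
    move=> xA yA; have := rank_ltn yA; rewrite adj_label // /c yA (negbTE xA) A4.
    by move=> ry /eqP->; apply: sn.
  move=> x y xy; case: (boolP (x \in A)) (boolP (y \in A)) => [] xA [] yA.
  - by rewrite /c xA yA (inj_in_eq rank_inj) // adj_neq.
  - by rewrite eq_sym c_mixed // adj_sym.
  - exact: c_mixed.
  - by rewrite /c (negbTE xA) (negbTE yA) sW.
have [/existsP[q /existsPn q_empty]|all_labels] :=
    boolP [exists q : 'I_4, ~~ [exists w, (w \notin A) && (label w == q)]].
  (* [A_q] is empty: its colour is free for the vertices far from [A]. *)
  have q4 := ltn_ord q.
  pose s i := if i == 4 then val q else
    if i.+1 %% 4 == q then i.+2 %% 4 else i.+1 %% 4.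
  have q_label w : w \notin A -> label w != q.
    by move=> wA; have := q_empty w; rewrite wA.
  have s_lt i : s i < 4 by rewrite /s; case: ifP => // _; case: ifP => _; lia.
  have s_neq i : i < 4 -> s i != i.
    by move=> i4; rewrite /s (ltn_eqF i4); case: ifP => _; lia.
  (* The cyclic predecessor of [q] skips [q] and takes the colour that the empty class would have
     had under the shift. *)
  have s_inj i j : i <= 4 -> j <= 4 -> i != q -> j != q -> i != j -> s i != s j.
    move: q q4 @s {s_lt s_neq q_empty q_label} => [m m4] /= _.
    by case: m m4 => [|[|[|[|m]]]] // _; case: i => [|[|[|[|[|i]]]]] //;
      case: j => [|[|[|[|[|j]]]]].
  apply: (coloring s) => // x y xA yA xy.
  by rewrite s_inj ?q_label ?indep.
have labelled i : i < 4 -> exists2 w, w \notin A & label w = i.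
  move=> i4; have /existsPn/(_ (Ordinal i4)) := all_labels; rewrite negbK.
  by move=> /existsP[w /andP[wA /eqP]]; exists w.
(* The vertices of [T] see both [z] and [y], hence form a clique with them. Three further labels are
   inhabited, so this clique has at least five vertices. *)
have isolated z y : z \notin A -> y \notin A -> adj z y -> label z = 4 -> False.
  move=> zA yA zy lz; have nzy := indep z y zA yA zy; rewrite lz in nzy.
  have ly : label y < 4 by rewrite ltn_neqAle eq_sym nzy label4.
  pose T := [set w | [&& w \notin A, label w < 4 & label w != label y]].
  have Tzy w : w \in T -> adj w z && adj w y.
    rewrite inE => /and3P[wA lw wy]; apply: (@edge_label_both [:: label w; label y]);
      by rewrite ?A4 ?lz ?inE ?eqxx ?orbT // ?(gtn_eqF lw) // eq_sym.
  have clT : clique (z |: (y |: T)).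
    apply: cliqueU1 => [|w]; last first.
      by rewrite in_setU1 => /orP[/eqP->//|/Tzy/andP[wz _]]; rewrite adj_sym.
    apply: cliqueU1 => [|w /Tzy/andP[_ wy]]; last by rewrite adj_sym.
    apply/cliqueP => w w' /Tzy/andP[wz wy] /Tzy/andP[w'z w'y].
    exact: (no_diamond hD wz wy w'z w'y zy).
  have := leq_omega clT; rewrite !cardsU1 !inE (negbTE (adj_neq zy)) lz eqxx !andbF.
  rewrite -cardA A4 => cT; have : 3 <= #|T|.
    rewrite cardE -(size_map label).
    have -> : 3 = size (rem (label y) (iota 0 4)) by rewrite size_rem ?mem_iota.
    apply: uniq_leq_size => [|i]; first by rewrite rem_uniq ?iota_uniq.
    rewrite mem_rem_uniq ?iota_uniq // inE mem_iota => /andP[iy i4].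
    have [w wA lw] := labelled i i4; apply/mapP; exists w => //.
    by rewrite mem_enum inE wA lw iy andbT.
  by lia.
(* Far vertices share colour 1 with the class of label 0, which is harmless as they are isolated. *)
apply: (coloring (fun i => i.+1 %% 4)) => // [i|i|x y xA yA xy]; try by lia.
have nx : label x != 4 by apply/eqP => /(isolated x y xA yA xy).
have ny : label y != 4.
  by apply/eqP => /(isolated y x yA xA); apply; rewrite adj_sym.
by have := indep x y xA yA xy; have := label4 x; have := label4 y; lia.
Qed.

(** Three vertices carry at most three labels, which leaves two vertices of [A] for [P3_label]. The
    resulting cluster structure and the single-neighbour property pass to the trace of [A] on any
    [S]. *)
Lemma omega5_perfect : 5 <= #|A| -> perfect G.
Proof.
move=> A5 S; apply/eqP; rewrite eqn_leq omega_leq_chi andbT.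
apply: (@cluster_coloring (induced S) [set u | val u \in A]).
- apply/cliqueP => u v; rewrite !inE => uA vA nuv.
  exact: (cliqueP _ clA).
- move=> w a b; rewrite !inE => wA aA bA wa wb.
  exact/val_inj/(max_clique_nbr wA aA bA).
- move=> x y z; rewrite !inE => xA yA zA xy yz nxz.
  by apply: (P3_label (t := [:: label (val x); label (val y); label (val z)]) _ xA yA zA _ _ _ xy yz);
    rewrite ?inE ?eqxx ?orbT.
Qed.

End MaximumClique.

Theorem theorem4p5 (G : sgraph)
    (hP : free P3_cup_P2 G) (hD : free diamond G) :
  [/\ omega G = 2 -> chi G <= 4,
      omega G = 3 -> chi G <= 6,
      omega G = 4 -> chi G <= 4
    & 5 <= omega G -> perfect G].
Proof.
have [A clA cardA] := omega_witness G; rewrite -cardA.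
split.
- exact: omega2_bound.
- exact: omega3_bound.
- exact: omega4_bound.
- exact: omega5_perfect.
Qed.
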